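(* If an s-hypersequent $\alpha_1\vdash\beta_1\mid\dots\mid\alpha_n\vdash\beta_n$ is valid in the class $\mathcal{KC}_{RT}$ of all reflexive and transitive Kripke contexts, then it is provable in $\mathbf{MPDBL4}$.
   Context: The logic PDBL. Variables: object variables $\mathbf{OV}$ ($p,\dots$) and property variables $\mathbf{PV}$ ($P,\dots$), disjoint countably infinite sets; constants $\top,\bot$; connectives $\sqcap,\sqcup$ (binary), $\neg,\lrcorner$ (unary). $\alpha\vee\beta:=\neg(\neg\alpha\sqcap\neg\beta)$, $\alpha\wedge\beta:=\lrcorner(\lrcorner\alpha\sqcup\lrcorner\beta)$. Sequents $\alpha\vdash\beta$ ($\alpha\dashv\vdash\beta$ means both directions); s-hypersequents are finite sequences $\alpha_1\vdash\beta_1\mid\dots\mid\alpha_n\vdash\beta_n$ (components); $B,C,\dots,X$ range over possibly empty s-hypersequents. Axioms: $\alpha\vdash\alpha$; $\alpha\sqcap\beta\vdash\alpha$; $\alpha\sqcap\beta\vdash\beta$; $\alpha\vdash\alpha\sqcup\beta$; $\beta\vdash\alpha\sqcup\beta$; $\alpha\sqcap\beta\vdash(\alpha\sqcap\beta)\sqcap(\alpha\sqcap\beta)$; $(\alpha\sqcup\beta)\sqcup(\alpha\sqcup\beta)\vdash\alpha\sqcup\beta$; $\neg(\alpha\sqcap\alpha)\vdash\neg\alpha$; $\lrcorner\alpha\vdash\lrcorner(\alpha\sqcup\alpha)$; $\alpha\sqcap\neg\alpha\vdash\bot$; $\top\vdash\alpha\sqcup\lrcorner\alpha$; $\neg\neg(\alpha\sqcap\beta)\dashv\vdash\alpha\sqcap\beta$;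 $\lrcorner\lrcorner(\alpha\sqcup\beta)\dashv\vdash\alpha\sqcup\beta$; $\alpha\sqcap\alpha\vdash\alpha\sqcap(\alpha\sqcup\beta)$; $\alpha\sqcup(\alpha\sqcap\beta)\vdash\alpha\sqcup\alpha$; $\alpha\sqcap\alpha\vdash\alpha\sqcap(\alpha\vee\beta)$; $\alpha\sqcup(\alpha\wedge\beta)\vdash\alpha\sqcup\alpha$; $\alpha\sqcap(\beta\vee\gamma)\dashv\vdash(\alpha\sqcap\beta)\vee(\alpha\sqcap\gamma)$; $\alpha\sqcup(\beta\wedge\gamma)\dashv\vdash(\alpha\sqcup\beta)\wedge(\alpha\sqcup\gamma)$; $\bot\vdash\alpha$; $\alpha\vdash\top$; $\neg\top\vdash\bot$; $\top\vdash\lrcorner\bot$; $\neg\bot\dashv\vdash\top\sqcap\top$; $\lrcorner\top\dashv\vdash\bot\sqcup\bot$; $(\alpha\sqcup\alpha)\sqcap(\alpha\sqcup\alpha)\dashv\vdash(\alpha\sqcap\alpha)\sqcup(\alpha\sqcap\alpha)$; $p\sqcap p\dashv\vdash p$ ($p\in\mathbf{OV}$); $P\sqcup P\dashv\vdash P$ ($P\in\mathbf{PV}$); (Sp) $\alpha\vdash\alpha\sqcap\alpha\mid\alpha\sqcup\alpha\vdash\alpha$. Rules: from $B\mid\alpha\vdash\beta\mid C$ infer $B\mid\alpha\sqcap\gamma\vdash\beta\sqcap\gamma\mid C$, $B\mid\gamma\sqcap\alpha\vdash\gamma\sqcap\beta\mid C$, $B\mid\alpha\sqcup\gamma\vdash\beta\sqcup\gamma\mid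 C$, $B\mid\gamma\sqcup\alpha\vdash\gamma\sqcup\beta\mid C$, $B\mid\neg\beta\vdash\neg\alpha\mid C$, $B\mid\lrcorner\beta\vdash\lrcorner\alpha\mid C$; from $B\mid\alpha\vdash\beta\mid C$ and $D\mid\beta\vdash\gamma\mid E$ infer $B\mid D\mid\alpha\vdash\gamma\mid C\mid E$; from $B\mid\alpha\sqcap\beta\vdash\alpha\sqcap\alpha\mid C$, $D\mid\alpha\sqcap\alpha\vdash\alpha\sqcap\beta\mid E$, $F\mid\alpha\sqcup\beta\vdash\beta\sqcup\beta\mid G$, $H\mid\beta\sqcup\beta\vdash\alpha\sqcup\beta\mid X$ infer $B\mid D\mid F\mid H\mid\alpha\vdash\beta\mid C\mid E\mid G\mid X$; external: from $B\mid D\mid D\mid C$ infer $B\mid D\mid C$; from $B\mid D\mid E\mid C$ infer $B\mid E\mid D\mid C$; from $B$ infer $B\mid C$. MPDBL and MPDBL4. $\mathbf{MPDBL}$ adds unary connectives $\square,\blacksquare$ (the PDBL schemes and rules range over all formulae of the enlarged language), with additional axioms $\square\alpha\sqcap\square\beta\dashv\vdash\square(\alpha\sqcap\beta)$; $\blacksquare\alpha\sqcup\blacksquare\beta\dashv\vdash\blacksquare(\alpha\sqcup\beta)$; $\square(\neg\bot)\dashv\vdash\neg\bot$; $\blacksquare(\lrcorner\top)\dashv\vdash\lrcorner\top$; $\square(\alpha\sqcap\alpha)\dashv\vdash\square\alpha$; $\blacksquare(\alpha\sqcup\alpha)\dashv\vdash\blacksquare\alpha$, and rules: from $B\mid\alpha\vdash\beta\mid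 C$ infer $B\mid\square\alpha\vdash\square\beta\mid C$ and $B\mid\blacksquare\alpha\vdash\blacksquare\beta\mid C$. $\mathbf{MPDBL4}$ is $\mathbf{MPDBL}$ plus the axioms $\square\alpha\vdash\alpha$, $\alpha\vdash\blacksquare\alpha$, $\square\square\alpha\dashv\vdash\square\alpha$, $\blacksquare\blacksquare\alpha\dashv\vdash\blacksquare\alpha$. Provability is via finite derivations. Kripke contexts and semiconcepts. A Kripke context is $\mathbb{KC}=((G,R),(M,S),I)$ where $(G,M,I)$ is a context ($I\subseteq G\times M$), $R$ is a binary relation on $G$ and $S$ a binary relation on $M$; it is reflexive (resp. transitive) if both $R$ and $S$ are reflexive (resp. transitive). For $A\subseteq G$, $A'=\{m:gIm\ \forall g\in A\}$; for $B\subseteq M$, $B'=\{g:gIm\ \forall m\in B\}$. A semiconcept of $(G,M,I)$ is a pair $(A,B)$ with $A'=B$ or $B'=A$; $ext(A,B)=A$, $int(A,B)=B$; $\mathfrak{H}$ denotes the set of semiconcepts with operations $(A_1,B_1)\sqcap(A_2,B_2)=(A_1\cap A_2,(A_1\cap A_2)')$, $(A_1,B_1)\sqcup(A_2,B_2)=((B_1\cap B_2)',B_1\cap B_2)$. Models. A model is $\mathbb{M}=(\mathbb{KC},v)$ with $v$ a map on $\mathbf{OV}\cup\mathbf{PV}\cup\{\top,\bot\}$ into $\mathfrak{H}$ with $v(p)\sqcap v(p)=v(p)$ ($p\in\mathbf{OV}$), $v(P)\sqcup v(P)=v(P)$ ($P\in\mathbf{PV}$), $v(\top)=(G,\emptyset)$,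 $v(\bot)=(\emptyset,M)$. Satisfaction $g\models\alpha$ ($g\in G$) and co-satisfaction $m\succ\alpha$ ($m\in M$): $g\models p$ iff $g\in ext(v(p))$; $g\models P$ iff $g\in ext(v(P))$; $g\models\top$ always; $g\not\models\bot$ always; $m\not\succ\top$ always; $m\succ\bot$ always; $g\models\alpha\sqcap\beta$ iff $g\models\alpha$ and $g\models\beta$; $g\models\neg\alpha$ iff $g\not\models\alpha$; $m\succ p$ iff $m\in int(v(p))$; $m\succ P$ iff $m\in int(v(P))$; $m\succ\alpha\sqcup\beta$ iff $m\succ\alpha$ and $m\succ\beta$; $m\succ\lrcorner\alpha$ iff $m\not\succ\alpha$; $g\models\alpha\sqcup\beta$ iff $\forall m(m\succ\alpha\sqcup\beta\Rightarrow gIm)$; $g\models\lrcorner\alpha$ iff $\forall m(m\not\succ\alpha\Rightarrow gIm)$; $m\succ\neg\alpha$ iff $\forall g(g\not\models\alpha\Rightarrow gIm)$; $m\succ\alpha\sqcap\beta$ iff $\forall g(g\models\alpha\sqcap\beta\Rightarrow gIm)$; $g\models\square\alpha$ iff for all $g_1$ with $gRg_1$, $g_1\models\alpha$; $m\succ\square\alpha$ iff $gIm$ for every $g\in G$ such that ($g_1\models\alpha$ for all $g_1$ with $gRg_1$); $m\succ\blacksquare\alpha$ iff for all $m_1$ with $mSm_1$, $m_1\succ\alpha$; $g\models\blacksquare\alpha$ iff $gIm$ for every $m\in M$ such that ($m_1\succ\alpha$ for all $m_1$ with $mSm_1$). A sequent $\alpha\vdash\beta$ is satisfied in $\mathbb{M}$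 iff $\forall g(g\models\alpha\Rightarrow g\models\beta)$ and $\forall m(m\succ\beta\Rightarrow m\succ\alpha)$; an s-hypersequent is satisfied iff some component is; true in $\mathbb{KC}$ iff satisfied in every model based on $\mathbb{KC}$; valid in a class iff true in each member. *)

(* Defs.v *)
From mathcomp Require Import all_boot.
From mathcomp Require Import classical_sets.
From Stdlib Require List.

Set Implicit Arguments.
Unset Strict Implicit.
Unset Printing Implicit Defensive.

Local Open Scope classical_set_scope.

(** * Syntax *)

Inductive atom :=
| OVar of nat
| PVar of nat
| Top
| Bot.

Inductive formula :=
| Atom of atom
| Meet of formula & formula
| Join of formula & formula
| Neg of formula
| Opp of formula
| Box of formula
| BBox of formula.

Declare Scope mpdbl_scope.
Delimit Scope mpdbl_scope with mpdbl.
Bind Scope mpdbl_scope with formula.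

Notation "⊤" := (Atom Top) : mpdbl_scope.
Notation "⊥" := (Atom Bot) : mpdbl_scope.
Notation "¬ a" := (Neg a) (at level 35, right associativity) : mpdbl_scope.
Notation "⌟ a" := (Opp a) (at level 35, right associativity) : mpdbl_scope.
Notation "□ a" := (Box a) (at level 35, right associativity) : mpdbl_scope.
Notation "■ a" := (BBox a) (at level 35, right associativity) : mpdbl_scope.
Notation "a ⊓ b" := (Meet a b) (at level 40, left associativity) : mpdbl_scope.
Notation "a ⊔ b" := (Join a b) (at level 40, left associativity) : mpdbl_scope.

Local Open Scope mpdbl_scope.

Definition vee (a b : formula) : formula := ¬ (¬ a ⊓ ¬ b).
Definition wedge (a b : formula) : formula := ⌟ (⌟ a ⊔ ⌟ b).

Notation "a ∨ b" := (vee a b) (at level 50, left associativity) : mpdbl_scope.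
Notation "a ∧ b" := (wedge a b) (at level 50, left associativity) : mpdbl_scope.

Record sequent := Sequent { lhs : formula; rhs : formula }.

Notation "a ⊢ b" := (Sequent a b) (at level 70, no associativity) : mpdbl_scope.

(* The separator | is concatenation, so the empty hypersequent is [::]. *)
Definition hypersequent := seq sequent.

(** * The calculi *)

(* For an axiom scheme with ⊣⊢, the suffixes _l and _r mark its two directions. *)
Inductive PDBL_axiom : hypersequent -> Prop :=
| ax_id a : PDBL_axiom [:: a ⊢ a]
| ax_meet_l a b : PDBL_axiom [:: a ⊓ b ⊢ a]
| ax_meet_r a b : PDBL_axiom [:: a ⊓ b ⊢ b]
| ax_join_l a b : PDBL_axiom [:: a ⊢ a ⊔ b]
| ax_join_r a b : PDBL_axiom [:: b ⊢ a ⊔ b]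
| ax_meet_idem a b : PDBL_axiom [:: a ⊓ b ⊢ (a ⊓ b) ⊓ (a ⊓ b)]
| ax_join_idem a b : PDBL_axiom [:: (a ⊔ b) ⊔ (a ⊔ b) ⊢ a ⊔ b]
| ax_neg_meet a : PDBL_axiom [:: ¬ (a ⊓ a) ⊢ ¬ a]
| ax_opp_join a : PDBL_axiom [:: ⌟ a ⊢ ⌟ (a ⊔ a)]
| ax_meet_neg a : PDBL_axiom [:: a ⊓ ¬ a ⊢ ⊥]
| ax_join_opp a : PDBL_axiom [:: ⊤ ⊢ a ⊔ ⌟ a]
| ax_negneg_l a b : PDBL_axiom [:: ¬ ¬ (a ⊓ b) ⊢ a ⊓ b]
| ax_negneg_r a b : PDBL_axiom [:: a ⊓ b ⊢ ¬ ¬ (a ⊓ b)]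
| ax_oppopp_l a b : PDBL_axiom [:: ⌟ ⌟ (a ⊔ b) ⊢ a ⊔ b]
| ax_oppopp_r a b : PDBL_axiom [:: a ⊔ b ⊢ ⌟ ⌟ (a ⊔ b)]
| ax_absorb_meet_join a b : PDBL_axiom [:: a ⊓ a ⊢ a ⊓ (a ⊔ b)]
| ax_absorb_join_meet a b : PDBL_axiom [:: a ⊔ (a ⊓ b) ⊢ a ⊔ a]
| ax_absorb_meet_vee a b : PDBL_axiom [:: a ⊓ a ⊢ a ⊓ (a ∨ b)]
| ax_absorb_join_wedge a b : PDBL_axiom [:: a ⊔ (a ∧ b) ⊢ a ⊔ a]
| ax_distr_meet_l a b c : PDBL_axiom [:: a ⊓ (b ∨ c) ⊢ (a ⊓ b) ∨ (a ⊓ c)]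
| ax_distr_meet_r a b c : PDBL_axiom [:: (a ⊓ b) ∨ (a ⊓ c) ⊢ a ⊓ (b ∨ c)]
| ax_distr_join_l a b c : PDBL_axiom [:: a ⊔ (b ∧ c) ⊢ (a ⊔ b) ∧ (a ⊔ c)]
| ax_distr_join_r a b c : PDBL_axiom [:: (a ⊔ b) ∧ (a ⊔ c) ⊢ a ⊔ (b ∧ c)]
| ax_bot a : PDBL_axiom [:: ⊥ ⊢ a]
| ax_top a : PDBL_axiom [:: a ⊢ ⊤]
| ax_neg_top : PDBL_axiom [:: ¬ ⊤ ⊢ ⊥]
| ax_opp_bot : PDBL_axiom [:: ⊤ ⊢ ⌟ ⊥]
| ax_neg_bot_l : PDBL_axiom [:: ¬ ⊥ ⊢ ⊤ ⊓ ⊤]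
| ax_neg_bot_r : PDBL_axiom [:: ⊤ ⊓ ⊤ ⊢ ¬ ⊥]
| ax_opp_top_l : PDBL_axiom [:: ⌟ ⊤ ⊢ ⊥ ⊔ ⊥]
| ax_opp_top_r : PDBL_axiom [:: ⊥ ⊔ ⊥ ⊢ ⌟ ⊤]
| ax_meet_join_l a :
    PDBL_axiom [:: (a ⊔ a) ⊓ (a ⊔ a) ⊢ (a ⊓ a) ⊔ (a ⊓ a)]
| ax_meet_join_r a :
    PDBL_axiom [:: (a ⊓ a) ⊔ (a ⊓ a) ⊢ (a ⊔ a) ⊓ (a ⊔ a)]
| ax_OVar_l i : PDBL_axiom [:: Atom (OVar i) ⊓ Atom (OVar i) ⊢ Atom (OVar i)]
| ax_OVar_r i : PDBL_axiom [:: Atom (OVar i) ⊢ Atom (OVar i) ⊓ Atom (OVar i)]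
| ax_PVar_l i : PDBL_axiom [:: Atom (PVar i) ⊔ Atom (PVar i) ⊢ Atom (PVar i)]
| ax_PVar_r i : PDBL_axiom [:: Atom (PVar i) ⊢ Atom (PVar i) ⊔ Atom (PVar i)]
| ax_Sp a : PDBL_axiom [:: a ⊢ a ⊓ a; a ⊔ a ⊢ a].

Inductive MPDBL_axiom : hypersequent -> Prop :=
| ax_PDBL h : PDBL_axiom h -> MPDBL_axiom h
| ax_box_meet_l a b : MPDBL_axiom [:: □ a ⊓ □ b ⊢ □ (a ⊓ b)]
| ax_box_meet_r a b : MPDBL_axiom [:: □ (a ⊓ b) ⊢ □ a ⊓ □ b]
| ax_bbox_join_l a b : MPDBL_axiom [:: ■ a ⊔ ■ b ⊢ ■ (a ⊔ b)]
| ax_bbox_join_r a b : MPDBL_axiom [:: ■ (a ⊔ b) ⊢ ■ a ⊔ ■ b]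
| ax_box_neg_bot_l : MPDBL_axiom [:: □ (¬ ⊥) ⊢ ¬ ⊥]
| ax_box_neg_bot_r : MPDBL_axiom [:: ¬ ⊥ ⊢ □ (¬ ⊥)]
| ax_bbox_opp_top_l : MPDBL_axiom [:: ■ (⌟ ⊤) ⊢ ⌟ ⊤]
| ax_bbox_opp_top_r : MPDBL_axiom [:: ⌟ ⊤ ⊢ ■ (⌟ ⊤)]
| ax_box_idem_l a : MPDBL_axiom [:: □ (a ⊓ a) ⊢ □ a]
| ax_box_idem_r a : MPDBL_axiom [:: □ a ⊢ □ (a ⊓ a)]
| ax_bbox_idem_l a : MPDBL_axiom [:: ■ (a ⊔ a) ⊢ ■ a]
| ax_bbox_idem_r a : MPDBL_axiom [:: ■ a ⊢ ■ (a ⊔ a)].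

Inductive MPDBL4_axiom : hypersequent -> Prop :=
| ax_MPDBL h : MPDBL_axiom h -> MPDBL4_axiom h
| ax_box_T a : MPDBL4_axiom [:: □ a ⊢ a]
| ax_bbox_T a : MPDBL4_axiom [:: a ⊢ ■ a]
| ax_box_4_l a : MPDBL4_axiom [:: □ □ a ⊢ □ a]
| ax_box_4_r a : MPDBL4_axiom [:: □ a ⊢ □ □ a]
| ax_bbox_4_l a : MPDBL4_axiom [:: ■ ■ a ⊢ ■ a]
| ax_bbox_4_r a : MPDBL4_axiom [:: ■ a ⊢ ■ ■ a].

Inductive derivable (axiom : hypersequent -> Prop) : hypersequent -> Prop :=
| d_axiom h : axiom h -> derivable axiom h
| d_meet_r B C a b c :
    derivable axiom (B ++ [:: a ⊢ b] ++ C) ->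
    derivable axiom (B ++ [:: a ⊓ c ⊢ b ⊓ c] ++ C)
| d_meet_l B C a b c :
    derivable axiom (B ++ [:: a ⊢ b] ++ C) ->
    derivable axiom (B ++ [:: c ⊓ a ⊢ c ⊓ b] ++ C)
| d_join_r B C a b c :
    derivable axiom (B ++ [:: a ⊢ b] ++ C) ->
    derivable axiom (B ++ [:: a ⊔ c ⊢ b ⊔ c] ++ C)
| d_join_l B C a b c :
    derivable axiom (B ++ [:: a ⊢ b] ++ C) ->
    derivable axiom (B ++ [:: c ⊔ a ⊢ c ⊔ b] ++ C)
| d_neg B C a b :
    derivable axiom (B ++ [:: a ⊢ b] ++ C) ->
    derivable axiom (B ++ [:: ¬ b ⊢ ¬ a] ++ C)
| d_opp B C a b :
    derivable axiom (B ++ [:: a ⊢ b] ++ C) ->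
    derivable axiom (B ++ [:: ⌟ b ⊢ ⌟ a] ++ C)
| d_cut B C D E a b c :
    derivable axiom (B ++ [:: a ⊢ b] ++ C) ->
    derivable axiom (D ++ [:: b ⊢ c] ++ E) ->
    derivable axiom (B ++ D ++ [:: a ⊢ c] ++ C ++ E)
| d_order B C D E F G H X a b :
    derivable axiom (B ++ [:: a ⊓ b ⊢ a ⊓ a] ++ C) ->
    derivable axiom (D ++ [:: a ⊓ a ⊢ a ⊓ b] ++ E) ->
    derivable axiom (F ++ [:: a ⊔ b ⊢ b ⊔ b] ++ G) ->
    derivable axiom (H ++ [:: b ⊔ b ⊢ a ⊔ b] ++ X) ->
    derivable axiom (B ++ D ++ F ++ H ++ [:: a ⊢ b] ++ C ++ E ++ G ++ X)
| d_contraction B C D :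
    derivable axiom (B ++ D ++ D ++ C) ->
    derivable axiom (B ++ D ++ C)
| d_exchange B C D E :
    derivable axiom (B ++ D ++ E ++ C) ->
    derivable axiom (B ++ E ++ D ++ C)
| d_weakening B C :
    derivable axiom B -> derivable axiom (B ++ C)
| d_box B C a b :
    derivable axiom (B ++ [:: a ⊢ b] ++ C) ->
    derivable axiom (B ++ [:: □ a ⊢ □ b] ++ C)
| d_bbox B C a b :
    derivable axiom (B ++ [:: a ⊢ b] ++ C) ->
    derivable axiom (B ++ [:: ■ a ⊢ ■ b] ++ C).

Definition MPDBL4_provable : hypersequent -> Prop := derivable MPDBL4_axiom.

(** * Kripke contexts and semiconcepts *)

Record kripke_context := KripkeContext {
  obj : Type;
  prp : Type;
  robj : obj -> obj -> Prop;
  rprp : prp -> prp -> Prop;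
  inc : obj -> prp -> Prop
}.

Definition reflexive_kc (K : kripke_context) : Prop :=
  RelationClasses.Reflexive (@robj K) /\ RelationClasses.Reflexive (@rprp K).

Definition transitive_kc (K : kripke_context) : Prop :=
  RelationClasses.Transitive (@robj K) /\ RelationClasses.Transitive (@rprp K).

Definition KC_RT (K : kripke_context) : Prop :=
  reflexive_kc K /\ transitive_kc K.

Section Semiconcepts.
Variable K : kripke_context.

Definition intent (A : set (obj K)) : set (prp K) :=
  [set m | forall g, A g -> inc g m].

Definition extent (B : set (prp K)) : set (obj K) :=
  [set g | forall m, B m -> inc g m].

Definition is_semiconcept (x : set (obj K) * set (prp K)) : Prop :=
  intent x.1 = x.2 \/ extent x.2 = x.1.

Definition sc_meet (x y : set (obj K) * set (prp K)) :
    set (obj K) * set (prp K) :=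
  (x.1 `&` y.1, intent (x.1 `&` y.1)).

Definition sc_join (x y : set (obj K) * set (prp K)) :
    set (obj K) * set (prp K) :=
  (extent (x.2 `&` y.2), x.2 `&` y.2).

End Semiconcepts.

(** * Models *)

Record model (K : kripke_context) := Model {
  valuation : atom -> set (obj K) * set (prp K);
  valuation_semiconcept : forall x, is_semiconcept (valuation x);
  valuation_OVar : forall i,
    sc_meet (valuation (OVar i)) (valuation (OVar i)) = valuation (OVar i);
  valuation_PVar : forall i,
    sc_join (valuation (PVar i)) (valuation (PVar i)) = valuation (PVar i);
  valuation_Top : valuation Top = (setT, set0);
  valuation_Bot : valuation Bot = (set0, setT)
}.

Section Satisfaction.
Variables (K : kripke_context) (v : model K).

(* The clauses [g ⊨ α ⊔ β], [g ⊨ ⌟ α], [g ⊨ ■ α], [m ≻ α ⊓ β], [m ≻ ¬ α] and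
   [m ≻ □ α] say that [g] (resp. [m]) is incident to everything that
   co-satisfies (resp. satisfies) the same formula; that hypothesis is written
   out here to keep the recursion structural, see [sat_Join] etc. below. *)
Fixpoint sat (a : formula) (g : obj K) {struct a} : Prop :=
  match a with
  | Atom (OVar i) => (valuation v (OVar i)).1 g
  | Atom (PVar i) => (valuation v (PVar i)).1 g
  | Atom Top => True
  | Atom Bot => False
  | Meet b c => sat b g /\ sat c g
  | Neg b => ~ sat b g
  | Box b => forall g1, robj g g1 -> sat b g1
  | Join b c => forall m, cosat b m /\ cosat c m -> inc g m
  | Opp b => forall m, ~ cosat b m -> inc g m
  | BBox b => forall m, (forall m1, rprp m m1 -> cosat b m1) -> inc g m
  end
with cosat (a : formula) (m : prp K) {struct a} : Prop :=
  match a with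
  | Atom (OVar i) => (valuation v (OVar i)).2 m
  | Atom (PVar i) => (valuation v (PVar i)).2 m
  | Atom Top => False
  | Atom Bot => True
  | Join b c => cosat b m /\ cosat c m
  | Opp b => ~ cosat b m
  | BBox b => forall m1, rprp m m1 -> cosat b m1
  | Meet b c => forall g, sat b g /\ sat c g -> inc g m
  | Neg b => forall g, ~ sat b g -> inc g m
  | Box b => forall g, (forall g1, robj g g1 -> sat b g1) -> inc g m
  end.

Lemma sat_Join a b g :
  sat (a ⊔ b) g <-> forall m, cosat (a ⊔ b) m -> inc g m.
Proof. by []. Qed.

Lemma sat_Opp a g : sat (⌟ a) g <-> forall m, cosat (⌟ a) m -> inc g m.
Proof. by []. Qed.

Lemma sat_BBox a g : sat (■ a) g <-> forall m, cosat (■ a) m -> inc g m.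
Proof. by []. Qed.

Lemma cosat_Meet a b m :
  cosat (a ⊓ b) m <-> forall g, sat (a ⊓ b) g -> inc g m.
Proof. by []. Qed.

Lemma cosat_Neg a m : cosat (¬ a) m <-> forall g, sat (¬ a) g -> inc g m.
Proof. by []. Qed.

Lemma cosat_Box a m : cosat (□ a) m <-> forall g, sat (□ a) g -> inc g m.
Proof. by []. Qed.

Definition sequent_satisfied (s : sequent) : Prop :=
  (forall g, sat (lhs s) g -> sat (rhs s) g) /\
  (forall m, cosat (rhs s) m -> cosat (lhs s) m).

Definition satisfied (h : hypersequent) : Prop :=
  List.Exists sequent_satisfied h.

End Satisfaction.

Definition true_in (K : kripke_context) (h : hypersequent) : Prop :=
  forall v : model K, satisfied v h.

Definition valid_in (C : kripke_context -> Prop) (h : hypersequent) : Prop :=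
  forall K, C K -> true_in K h.

(* Main.v *)
Require Import Defs.
From mathcomp Require Import all_boot.
From mathcomp Require Import boolp classical_sets.
From Stdlib Require List.

(** Let [h] be unprovable. By Zorn's lemma [h] extends to a maximal set [D] of
    sequents no finite part of which is provable as a hypersequent. The sequents
    outside [D] form a theory closed under all rules, and by (Sp) each formula
    [a] satisfies [a ⊢ a ⊓ a] or [a ⊔ a ⊢ a] in this theory. In its canonical
    Kripke context the objects are the sets of formulae that are ultrafilters
    for [⊓] and [¬], the properties are the ultrafilters of the opposite
    preorder for [⊔] and [⌟], and [F] is incident to [J] iff they share a
    formula. Satisfaction is membership, so the rule that derives [a ⊢ b] from
    [a ⊓ b ⊣⊢ a ⊓ a] and [a ⊔ b ⊣⊢ b ⊔ b] shows that the canonical model refutes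
    every sequent of [D], in particular every component of [h]. *)

Set Implicit Arguments.
Unset Strict Implicit.
Unset Printing Implicit Defensive.

Local Open Scope classical_set_scope.

(** * Maximal sets avoiding a finitary property *)

(** Zorn's lemma applies because a finite list drawn from the union of a chain already lies in one
    member. It serves twice: for sets of sequents and for filters. *)
Lemma maximal_avoiding (T : Type) (bad : seq T -> Prop) (A0 : set T) :
  (forall l l', List.incl l l' -> bad l -> bad l') ->
  (forall l, List.Forall A0 l -> ~ bad l) ->
  exists A : set T, [/\ A0 `<=` A, forall l, List.Forall A l -> ~ bad l &
    forall x, ~ A x -> exists2 l, List.Forall A l & bad (x :: l)].
Proof.
move=> bad_incl A0_ok.
(* Adjoining [A0] inside the test makes [P] hold for the union of the empty chain. *)
pose P (A : set T) := forall l, List.Forall (A0 `|` A) l -> ~ bad l.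
have [|A [PA maxA]] := @Zorn_bigcup T P.
  move=> C CP Ctot l lC.
  have [X [XC lX]] : exists X, (C X \/ X = set0) /\ List.Forall (A0 `|` X) l.
    elim: lC => [|x {}l xC _ [X [XC lX]]].
      by exists set0; split; [right|constructor].
    case: xC => [x0|[Y CY Yx]].
      by exists X; split=> //; constructor => //; left.
    have [XY|YX] : X `<=` Y \/ Y `<=` X.
      by case: XC => [CX|->]; [exact: Ctot | left].
    - exists Y; split; first by left.
      constructor; first by right.
      by apply: List.Forall_impl lX => z [|/XY]; [left|right].
    - exists X; split=> //; constructor=> //.
      by right; exact: YX.
  case: XC lX => [CX|->] lX; first exact: CP lX.
  by apply: A0_ok; apply: List.Forall_impl lX => z [].
exists (A0 `|` A); split=> // x nAx.
have /maxA/existsNP [l /not_implyP [lA /contrapT bad_l]] : A `<` A `|` [set x].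
  split=> [|/(_ x) xA]; first by left.
  by apply: nAx; right; apply: xA; right.
(* All occurrences of [x] in the bad list are merged into one at the head. *)
have [l' l'A ll'] : exists2 l', List.Forall (A0 `|` A) l' & List.incl l (x :: l').
  elim: lA => [|y {bad_l}l yA _ [l' l'A ll']]; first by exists [::].
  have [{}yA|->] : (A0 `|` A) y \/ y = x.
    by case: yA => [|[|]]; [left; left|left; right|right].
  - exists (y :: l'); first by constructor.
    move=> z /= [->|/ll' /= [->|]]; by [right; left|left|right; right].
  - by exists l' => // z /= [->|/ll']; [left|].
by exists l' => //; exact: bad_incl bad_l.
Qed.

(** * Preordered Boolean algebras with an S4 operator *)

(* [meet] is a meet only for the elements [x] with [x <= meet x x]; these form
   a Boolean algebra up to equivalence. Reversing the order turns [⊔], [⌟], [■]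
   into a second instance of the same structure. *)
Record s4_preorder (X : Type) (le : X -> X -> Prop) (meet : X -> X -> X)
    (neg box : X -> X) (top bot : X) : Prop := S4Preorder {
  le_refl a : le a a;
  le_trans a b c : le a b -> le b c -> le a c;
  meet_lel a b : le (meet a b) a;
  meet_ler a b : le (meet a b) b;
  le_meet2r a b c : le a b -> le (meet a c) (meet b c);
  le_meet2l a b c : le a b -> le (meet c a) (meet c b);
  meet_le_idem a b : le (meet a b) (meet (meet a b) (meet a b));
  neg_anti a b : le a b -> le (neg b) (neg a);
  neg_meet_idem a : le (neg (meet a a)) (neg a);
  meet_neg_bot a : le (meet a (neg a)) bot;
  negneg_le a b : le (neg (neg (meet a b))) (meet a b);
  meet_distr a b c :
    le (meet a (neg (meet (neg b) (neg c))))
       (neg (meet (neg (meet a b)) (neg (meet a c))));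
  bot_le a : le bot a;
  le_top a : le a top;
  top_le_neg_bot : le (meet top top) (neg bot);
  box_mono a b : le a b -> le (box a) (box b);
  box_meet a b : le (meet (box a) (box b)) (box (meet a b));
  box_meet_le a b : le (box (meet a b)) (meet (box a) (box b));
  box_neg_bot : le (neg bot) (box (neg bot));
  box_idem a : le (box a) (box (meet a a));
  box_T a : le (box a) a;
  box_4 a : le (box a) (box (box a))
}.

Record is_ultra (X : Type) (le : X -> X -> Prop) (meet : X -> X -> X)
    (neg : X -> X) (F : set X) : Prop := IsUltra {
  ultra_up a b : le a b -> F a -> F b;
  ultra_meet a b : F a -> F b -> F (meet a b);
  ultra_neg a : F (neg a) <-> ~ F a
}.

Section S4Preorder.
Variables (X : Type) (le : X -> X -> Prop) (meet : X -> X -> X).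
Variables (neg box : X -> X) (top bot : X).
Hypothesis S : s4_preorder le meet neg box top bot.

Local Notation "a <= b" := (le a b).
Local Notation ultra := (is_ultra le meet neg).

(** Substitute for the universal property of meets: [meet c c <= meet a c <= meet a b]. Since [c]
    need not lie below [meet c c], the bound is stated for [d]. *)
Lemma le_meet a b c d : c <= a -> c <= b -> d <= meet c c -> d <= meet a b.
Proof.
move=> ca cb dc; apply: (le_trans S dc).
exact: (le_trans S (le_meet2r S c ca) (le_meet2l S a cb)).
Qed.

(** [neg a <= neg (meet a a) <= neg (neg (neg a))], and any double negation [neg (neg b)] lies below
    [meet b b]. *)
Lemma neg_le_idem a : neg a <= meet (neg a) (neg a).
Proof.
have nn b : neg (neg b) <= meet b b.
  apply: (le_trans S _ (negneg_le S b b)).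
  by apply/(neg_anti S)/(neg_meet_idem S).
apply: (le_trans S _ (nn _)).
apply: (le_trans S (neg_anti S (meet_lel S a a))).
apply: (le_trans S _ (neg_anti S (nn a))).
by apply/(neg_anti S)/(le_refl S).
Qed.

(** With [neg (meet (neg y) (neg z))] as the join of [y] and [z], distribute [x] over the join of
    [y] and [neg y]. The summand [meet x (neg y)] lies below [bot] and drops out, leaving
    [meet x y]. *)
Lemma le_of_meet_neg x y : meet x (neg y) <= bot -> meet x x <= y.
Proof.
move=> xy.
have excluded_middle : meet top top <= neg (meet (neg y) (neg (neg y))).
  apply: (le_trans S (top_le_neg_bot S)).
  exact: (neg_anti S (meet_neg_bot S (neg y))).
have join_bot z : neg (neg z) <= z -> neg (meet (neg z) (neg bot)) <= z.
  apply: (le_trans S); apply: (neg_anti S).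
  apply: le_meet (neg_le_idem z); first exact: (le_refl S).
  exact: (neg_anti S (bot_le S z)).
apply: (le_trans S _ (meet_ler S x y)).
apply: (le_trans S _ (join_bot _ (negneg_le S x y))).
have x_top : meet x x <= meet top top.
  apply: le_meet (meet_le_idem S x x); exact: (le_top S).
apply: (@le_trans _ _ _ _ _ _ _ S _ (meet x (meet top top))).
  exact: le_meet (meet_lel S x x) x_top (meet_le_idem S x x).
apply: (le_trans S (le_meet2l S x excluded_middle)).
apply: (le_trans S (meet_distr S _ _ _)).
apply/(neg_anti S)/(le_meet2l S)/(neg_anti S)/xy.
Qed.

Lemma box_le_idem a : box a <= meet (box a) (box a).
Proof. exact: (le_trans S (box_idem S a) (box_meet_le S a a)). Qed.

(** * Ultrafilters: extension, separation and disjointness from an ideal *)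

Lemma ultra_meetE F a b : ultra F -> F (meet a b) <-> F a /\ F b.
Proof.
move=> uF; split=> [Fab|[]]; last exact: (ultra_meet uF).
by split; apply: (ultra_up uF) Fab; [exact: (meet_lel S)|exact: (meet_ler S)].
Qed.

Lemma ultra_top F : ultra F -> F top.
Proof.
move=> uF; have [Ft|/(ultra_neg uF)] := pselect (F top); first by [].
exact: (ultra_up uF (le_top S _)).
Qed.

Lemma ultra_bot F : ultra F -> ~ F bot.
Proof.
move=> uF Fb; have /(ultra_neg uF) := ultra_up uF (bot_le S (neg bot)) Fb.
exact.
Qed.

Lemma ultra_neg_bot F : ultra F -> F (neg bot).
Proof. by move=> uF; apply/(ultra_neg uF)/ultra_bot. Qed.

Let meets (l : seq X) : X := foldr meet top l.

Lemma meets_le a l : List.In a l -> meets l <= a.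
Proof.
elim: l => //= b l IH [->|/IH]; first exact: (meet_lel S).
by apply: (le_trans S); exact: (meet_ler S).
Qed.

Lemma le_meets c l :
  c <= meet c c -> (forall a, List.In a l -> c <= a) -> c <= meets l.
Proof.
move=> cc; elim: l => [|a l IH] cl /=; first exact: (le_top S).
by apply: le_meet cc; [apply: cl; left|apply: IH => b bl; apply: cl; right].
Qed.

(** [meets l'] is idempotent once [l'] is nonempty, which a head of [l] guarantees; for empty [l]
    the bound is [top]. *)
Lemma meets_incl l l' : List.incl l l' -> meets l' <= meets l.
Proof.
case: l => [|a l] ll'; first exact: (le_top S).
apply: le_meets => [|b /ll']; last exact: meets_le.
by case: l' ll' => [/(_ a (or_introl erefl))|b l' _] //; exact: (meet_le_idem S).
Qed.

(** A set maximal among those containing [P] whose finite meets are not below [bot] is an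
    ultrafilter. *)
Lemma ultrafilter_extension (P : set X) :
  P !=set0 -> (forall a b, a <= b -> P a -> P b) ->
  (forall a b, P a -> P b -> P (meet a b)) -> ~ P bot ->
  exists2 F, ultra F & P `<=` F.
Proof.
move=> [p Pp] Pup Pmeet Pbot.
pose bad l := meets l <= bot.
have bad_incl l l' : List.incl l l' -> bad l -> bad l'.
  by move=> /meets_incl; exact: (le_trans S).
have [l Pl|F [PF Fok Fmax]] := maximal_avoiding (A0 := P) bad_incl.
  apply: contra_not Pbot => /Pup; apply.
  elim: Pl => [|a l' Pa _ IH] /=; first exact: Pup (le_top S p) Pp.
  exact: Pmeet.
exists F => //; split=> [a b ab Fa|a b Fa Fb|a].
- apply: contrapT => /Fmax [l Fl bl]; apply: (Fok (a :: l)); first by constructor.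
  by apply: (le_trans S) bl => /=; exact: (le_meet2r S).
- apply: contrapT => /Fmax [l Fl bl].
  apply: (Fok [:: a, b & l]); first by do !constructor.
  apply: (le_trans S) bl; have cc := meet_le_idem S a (meets (b :: l)).
  apply: (le_meet _ _ cc); last first.
    by apply: (@meets_incl l [:: a, b & l]) => c; right; right.
  by apply: (le_meet _ _ cc); apply: (@meets_le _ [:: a, b & l]) => /=; auto.
- split=> [Fna Fa|nFa].
    apply: (Fok [:: neg a; a]); first by do !constructor.
    apply: (le_trans S) (meet_neg_bot S a).
    by apply: le_meet (meet_le_idem S _ _); apply: (@meets_le _ [:: neg a; a]) => /=; auto.
  apply: contrapT => /Fmax [l Fl bl]; have [l' Fl' bl'] := Fmax _ nFa.
  (* Let [c] be the meet of this list; the extra [p] keeps the list nonempty, so [c] is idempotent.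
     As [meet c (neg a) <= bot], first [c <= a], and then [c <= meet a (meets l') <= bot]. *)
  apply: (Fok (p :: l ++ l')).
    by constructor; [exact: PF|apply/List.Forall_app; split].
  have l_le : meets (p :: l ++ l') <= meets l.
    by apply: meets_incl => c cl; right; apply/List.in_or_app; left.
  have l'_le : meets (p :: l ++ l') <= meets l'.
    by apply: meets_incl => c cl; right; apply/List.in_or_app; right.
  have cc : meets (p :: l ++ l') <= meet (meets (p :: l ++ l')) (meets (p :: l ++ l')).
    exact: (meet_le_idem S).
  apply: (le_trans S) bl'; apply: (le_meet _ l'_le cc).
  apply: (le_trans S cc); apply: le_of_meet_neg.
  apply: (le_trans S) bl; apply: le_meet (meet_le_idem S _ _).
    exact: (meet_ler S).
  exact: (le_trans S (meet_lel S _ _)).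
Qed.

Lemma ultra_separation a b :
  ~ meet a a <= b -> exists F, [/\ ultra F, F a & ~ F b].
Proof.
move=> ab; have [| | | |F uF PF] := @ultrafilter_extension [set z | meet a (neg b) <= z].
- by exists (meet a (neg b)); exact: (le_refl S).
- by move=> c d cd /= /(le_trans S); exact.
- by move=> c d /= /le_meet cd /cd; apply; exact: (meet_le_idem S).
- by move=> /le_of_meet_neg.
exists F; split=> //; first exact/PF/(meet_lel S).
by apply/(ultra_neg uF)/PF; exact: (meet_ler S).
Qed.

Lemma ultra_disjoint (J : set X) x :
  J !=set0 -> (forall a b, a <= b -> J b -> J a) ->
  (forall a b, J a -> J b -> exists c, [/\ J c, a <= c & b <= c]) ->
  x <= meet x x -> ~ J x ->
  exists F, [/\ ultra F, F x & forall a, J a -> ~ F a].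
Proof.
move=> [j Jj] Jdown Jdir xx nJx.
pose P : set X := [set z | exists2 y, J y & meet x (neg y) <= z].
have [| | | |F uF PF] := @ultrafilter_extension P.
- by exists x, j => //; exact: (meet_lel S).
- by move=> a b ab [y Jy ya]; exists y => //; exact: (le_trans S ya).
- move=> a b [y Jy ya] [z Jz zb]; have [c [Jc yc zc]] := Jdir _ _ Jy Jz.
  exists c => //; apply: le_meet (meet_le_idem S _ _).
    by apply: (le_trans S _ ya); apply/(le_meet2l S)/(neg_anti S).
  by apply: (le_trans S _ zb); apply/(le_meet2l S)/(neg_anti S).
- by move=> [y Jy /le_of_meet_neg xy]; apply: nJx; apply: Jdown Jy; exact: (le_trans S xx).
exists F; split=> //; first by apply: PF; exists j => //; exact: (meet_lel S).
by move=> a Ja; apply/(ultra_neg uF)/PF; exists a => //; exact: (meet_ler S).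
Qed.

(** * Canonical accessibility and the existence lemma for the box *)

Definition canonical_rel (F F1 : set X) := forall a, F (box a) -> F1 a.

Lemma canonical_rel_refl F : ultra F -> canonical_rel F F.
Proof. by move=> uF a; exact: (ultra_up uF (box_T S a)). Qed.

Lemma canonical_rel_trans F F1 F2 :
  ultra F -> canonical_rel F F1 -> canonical_rel F1 F2 -> canonical_rel F F2.
Proof. by move=> uF R1 R2 a /(ultra_up uF (box_4 S a))/R1/R2. Qed.

(** If [box a] is not in [F], the filter generated by [neg a] and all [y] with [box y] in [F] avoids
    [bot]: otherwise [meet y y <= a], whence [box y <= box (meet y y) <= box a]. *)
Lemma ultra_box F a :
  ultra F -> F (box a) <-> forall F1, ultra F1 -> canonical_rel F F1 -> F1 a.
Proof.
move=> uF; split=> [Fa F1 _|Fa]; first exact.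
apply: contrapT => nFa.
pose P : set X := [set z | exists2 y, F (box y) & meet y (neg a) <= z].
(* This box makes the generated filter nonempty. *)
have Fnb : F (box (neg bot)) by apply: (ultra_up uF (box_neg_bot S)); exact: ultra_neg_bot.
have [| | | |F1 uF1 PF1] := @ultrafilter_extension P.
- by exists (meet (neg bot) (neg a)), (neg bot) => //; exact: (le_refl S).
- by move=> b c bc [y Fy yb]; exists y => //; exact: (le_trans S yb).
- move=> b c [y Fy yb] [z Fz zc]; exists (meet y z).
    by apply: (ultra_up uF (box_meet S _ _)); exact: (ultra_meet uF).
  apply: le_meet (meet_le_idem S _ _).
    by apply: (le_trans S _ yb); apply/(le_meet2r S)/(meet_lel S).
  by apply: (le_trans S _ zc); apply/(le_meet2r S)/(meet_ler S).
- move=> [y Fy /le_of_meet_neg /(box_mono S) ya]; apply: nFa.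
  by apply: (ultra_up uF ya); exact: (ultra_up uF (box_idem S y)).
have : F1 (neg a) by apply: PF1; exists (neg bot) => //; exact: (meet_ler S).
move=> /(ultra_neg uF1); apply; apply: Fa => // y Fy.
by apply: PF1; exists y => //; exact: (meet_lel S).
Qed.

End S4Preorder.

(** * Derivable hypersequents *)

Local Open Scope mpdbl_scope.

(** Weaken to [l ++ l'], then absorb each member of [l] into its copy in [l']. *)
Lemma derivable_incl ax l l' :
  List.incl l l' -> derivable ax l -> derivable ax l'.
Proof.
move=> ll' ld; have {ld} : derivable ax (l ++ l') by exact: d_weakening.
elim: l ll' => //= x l IH ll' xd; apply: IH => [y yl|]; first by apply: ll'; right.
have [l1 [l2 El']] := List.in_split x l' (ll' x (or_introl erefl)).
have {ll'}-> : l' = l1 ++ [:: x] ++ l2 by exact: El'.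
(* Exchange moves the leading [x] next to its copy in [l'], and contraction merges the two. *)
have := @d_contraction ax (l ++ l1) l2 [:: x].
have := @d_exchange ax [::] ([:: x] ++ l2) [:: x] (l ++ l1).
rewrite -!catA /= => exch contr; apply/contr/exch.
by rewrite El' in xd.
Qed.

(** The calculus on single sequents, without side components; (Sp) turns into the disjunction
    [theory_pure]. *)
Record is_theory (T : set sequent) : Prop := IsTheory {
  theory_axiom s : MPDBL4_axiom [:: s] -> T s;
  theory_cut a b c : T (a ⊢ b) -> T (b ⊢ c) -> T (a ⊢ c);
  theory_meet_r a b c : T (a ⊢ b) -> T (a ⊓ c ⊢ b ⊓ c);
  theory_meet_l a b c : T (a ⊢ b) -> T (c ⊓ a ⊢ c ⊓ b);
  theory_join_r a b c : T (a ⊢ b) -> T (a ⊔ c ⊢ b ⊔ c);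
  theory_join_l a b c : T (a ⊢ b) -> T (c ⊔ a ⊢ c ⊔ b);
  theory_neg a b : T (a ⊢ b) -> T (¬ b ⊢ ¬ a);
  theory_opp a b : T (a ⊢ b) -> T (⌟ b ⊢ ⌟ a);
  theory_box a b : T (a ⊢ b) -> T (□ a ⊢ □ b);
  theory_bbox a b : T (a ⊢ b) -> T (■ a ⊢ ■ b);
  theory_order a b :
    T (a ⊓ b ⊢ a ⊓ a) -> T (a ⊓ a ⊢ a ⊓ b) ->
    T (a ⊔ b ⊢ b ⊔ b) -> T (b ⊔ b ⊢ a ⊔ b) -> T (a ⊢ b);
  theory_pure a : T (a ⊢ a ⊓ a) \/ T (a ⊔ a ⊢ a)
}.

Lemma theory_avoiding h :
  ~ MPDBL4_provable h ->
  exists2 T, is_theory T & forall s, List.In s h -> ~ T s.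
Proof.
move=> nh.
have [l lh|D [hD Dok Dmax]] :=
  maximal_avoiding (A0 := fun s => List.In s h) (@derivable_incl MPDBL4_axiom).
  apply: contra_not nh; apply: derivable_incl => s sl.
  by move/List.Forall_forall: lh; exact.
(* By maximality [Q] describes the complement of [D]; its list [l] supplies the side components with
   which the rules are applied. *)
pose Q s := exists2 l, List.Forall D l & derivable MPDBL4_axiom (s :: l).
have TQ s : Q s -> ~ D s.
  by move=> [l lD sl] Ds; apply: (Dok (s :: l)) => //; constructor.
have QT s : ~ D s -> Q s by move/Dmax.
have unary s s' : (forall l, derivable MPDBL4_axiom ([::] ++ [:: s] ++ l) ->
    derivable MPDBL4_axiom ([::] ++ [:: s'] ++ l)) -> ~ D s -> ~ D s'.
  by move=> ss' /QT [l lD /ss' s'l]; apply: TQ; exists l.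
exists (fun s => ~ D s) => [|s /hD Ds]; last exact.
split.
- by move=> s sax; apply: TQ; exists [::] => //; exact: d_axiom.
- move=> a b c /QT [l lD al] /QT [l' lD' bl']; apply: TQ; exists (l ++ l').
    by apply/List.Forall_app.
  exact: (@d_cut _ [::] l [::] l' a b c).
- by move=> a b c; apply: unary => l; exact: d_meet_r.
- by move=> a b c; apply: unary => l; exact: d_meet_l.
- by move=> a b c; apply: unary => l; exact: d_join_r.
- by move=> a b c; apply: unary => l; exact: d_join_l.
- by move=> a b; apply: unary => l; exact: d_neg.
- by move=> a b; apply: unary => l; exact: d_opp.
- by move=> a b; apply: unary => l; exact: d_box.
- by move=> a b; apply: unary => l; exact: d_bbox.
- move=> a b /QT [l1 D1 d1] /QT [l2 D2 d2] /QT [l3 D3 d3] /QT [l4 D4 d4].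
  apply: TQ; exists (l1 ++ l2 ++ l3 ++ l4).
    by rewrite !List.Forall_app.
  exact: (@d_order _ [::] l1 [::] l2 [::] l3 [::] l4 a b).
(* If both sequents were in [D], the axiom (Sp) would be a derivable list from [D]. *)
- move=> a; apply: contrapT => /not_orP [/contrapT Da /contrapT Da'].
  apply: (Dok [:: a ⊢ a ⊓ a; a ⊔ a ⊢ a]); first by do !constructor.
  by apply/d_axiom/ax_MPDBL/ax_PDBL/ax_Sp.
Qed.

(** * The canonical model *)

Section CanonicalModel.
Variables (T : set sequent) (hT : is_theory T).

Let le a b := T (a ⊢ b).
Let ge a b := T (b ⊢ a).

Lemma theory_PDBL s : PDBL_axiom [:: s] -> T s.
Proof. by move=> ?; apply/(theory_axiom hT)/ax_MPDBL/ax_PDBL. Qed.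

Lemma theory_MPDBL s : MPDBL_axiom [:: s] -> T s.
Proof. by move=> ?; apply/(theory_axiom hT)/ax_MPDBL. Qed.

Lemma meet_s4_preorder : s4_preorder le Meet Neg Box ⊤ ⊥.
Proof.
split; rewrite /le; try by move=> *; apply: theory_PDBL; constructor.
- exact: (theory_cut hT).
- exact: (theory_meet_r hT).
- exact: (theory_meet_l hT).
- exact: (theory_neg hT).
- exact: (theory_box hT).
- by move=> *; apply: theory_MPDBL; constructor.
- by move=> *; apply: theory_MPDBL; constructor.
- by move=> *; apply: theory_MPDBL; constructor.
- by move=> *; apply: theory_MPDBL; constructor.
- by move=> *; apply: (theory_axiom hT); constructor.
- by move=> *; apply: (theory_axiom hT); constructor.
Qed.

Lemma join_s4_preorder : s4_preorder ge Join Opp BBox ⊥ ⊤.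
Proof.
split; rewrite /ge; try by move=> *; apply: theory_PDBL; constructor.
- by move=> a b c ab bc; exact: (theory_cut hT bc ab).
- by move=> a b c; exact: (theory_join_r hT).
- by move=> a b c; exact: (theory_join_l hT).
- by move=> a b; exact: (theory_opp hT).
- by move=> a b; exact: (theory_bbox hT).
- by move=> *; apply: theory_MPDBL; constructor.
- by move=> *; apply: theory_MPDBL; constructor.
- by move=> *; apply: theory_MPDBL; constructor.
- by move=> *; apply: theory_MPDBL; constructor.
- by move=> *; apply: (theory_axiom hT); constructor.
- by move=> *; apply: (theory_axiom hT); constructor.
Qed.

Let SM := meet_s4_preorder.
Let SJ := join_s4_preorder.

Let cobj := {F : set formula | is_ultra le Meet Neg F}.
Let cprp := {J : set formula | is_ultra ge Join Opp J}.

Definition canonical_kc : kripke_context :=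
  @KripkeContext cobj cprp
    (fun F F1 => canonical_rel Box (sval F) (sval F1))
    (fun J J1 => canonical_rel BBox (sval J) (sval J1))
    (fun F J => exists2 a, sval F a & sval J a).

Local Notation K := canonical_kc.

Lemma canonical_kc_RT : KC_RT K.
Proof.
do 2!split.
- by move=> [F uF] /=; exact: (canonical_rel_refl SM).
- by move=> [J uJ] /=; exact: (canonical_rel_refl SJ).
- by move=> [F uF] F1 F2 /=; exact: (canonical_rel_trans SM).
- by move=> [J uJ] J1 J2 /=; exact: (canonical_rel_trans SJ).
Qed.

Definition canonical_ext (a : formula) : set (obj K) := [set F | sval F a].
Definition canonical_int (a : formula) : set (prp K) := [set J | sval J a].

(** [J] is an ideal for [le]. If it misses [a], some ultrafilter contains [a] and is disjoint from
    [J], hence is not incident to it. *)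
Lemma intent_canonical_ext a :
  T (a ⊢ a ⊓ a) -> intent (canonical_ext a) = canonical_int a.
Proof.
move=> aa; apply/seteqP; split=> [[J uJ] /= Ja|J Ja F Fa]; last by exists a.
apply: contrapT => nJa.
have [| | |F [uF Fa FJ]] := ultra_disjoint SM (J := J) _ _ _ aa nJa.
- by exists ⊥; exact: (ultra_top SJ).
- by move=> b c bc; exact: (ultra_up uJ bc).
- move=> b c Jb Jc; exists (b ⊔ c); split; first exact: (ultra_meet uJ).
    exact: (meet_lel SJ).
  exact: (meet_ler SJ).
by have [b /= Fb /FJ] := Ja (exist _ F uF) Fa; exact.
Qed.

Lemma extent_canonical_int a :
  T (a ⊔ a ⊢ a) -> extent (canonical_int a) = canonical_ext a.
Proof.
move=> aa; apply/seteqP; split=> [[F uF] /= Fa|F Fa J Ja]; last by exists a.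
apply: contrapT => nFa.
have [| | |J [uJ Ja JF]] := ultra_disjoint SJ (J := F) _ _ _ aa nFa.
- by exists ⊤; exact: (ultra_top SM).
- by move=> b c bc; exact: (ultra_up uF bc).
- move=> b c Fb Fc; exists (b ⊓ c); split; first exact: (ultra_meet uF).
    exact: (meet_lel SM).
  exact: (meet_ler SM).
by have [b /= Fb /JF] := Fa (exist _ J uJ) Ja; exact.
Qed.

Let cval (x : atom) := (canonical_ext (Atom x), canonical_int (Atom x)).

Lemma canonical_semiconcept x : is_semiconcept (cval x).
Proof.
have [xx|xx] := theory_pure hT (Atom x); [left|right].
  exact: intent_canonical_ext.
exact: extent_canonical_int.
Qed.

Lemma canonical_OVar i : sc_meet (cval (OVar i)) (cval (OVar i)) = cval (OVar i).
Proof.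
rewrite /sc_meet setIid intent_canonical_ext//.
by apply: theory_PDBL; constructor.
Qed.

Lemma canonical_PVar i : sc_join (cval (PVar i)) (cval (PVar i)) = cval (PVar i).
Proof.
rewrite /sc_join setIid extent_canonical_int//.
by apply: theory_PDBL; constructor.
Qed.

Lemma canonical_Top : cval Top = (setT, set0).
Proof.
congr pair; apply/seteqP; split=> //.
  by move=> [F uF] _; exact: (ultra_top SM).
by move=> [J uJ]; exact: (ultra_bot SJ).
Qed.

Lemma canonical_Bot : cval Bot = (set0, setT).
Proof.
congr pair; apply/seteqP; split=> //.
  by move=> [F uF]; exact: (ultra_bot SM).
by move=> [J uJ] _; exact: (ultra_top SJ).
Qed.

Definition canonical_model : model K :=
  Model canonical_semiconcept canonical_OVar canonical_PVar
    canonical_Top canonical_Bot.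

Local Notation v := canonical_model.

(** Both halves go by one induction, since the clauses of [sat] and [cosat] refer to each other. For
    each connective one half follows from the ultrafilter laws. *)
Lemma truth a :
  (forall F, sat v a F <-> sval F a) /\ (forall J, cosat v a J <-> sval J a).
Proof.
(* The other half is read off through incidence, as the compound formula is idempotent for [⊓] or
   for [⊔]. *)
have intE b : T (b ⊢ b ⊓ b) -> (forall F, sat v b F <-> sval F b) ->
    forall J : prp K, (forall F, sat v b F -> inc F J) <-> sval J b.
  move=> bb satE J; rewrite -[sval J b]/(canonical_int b J).
  by rewrite -intent_canonical_ext//; split=> H F Fb; apply: H; apply/satE.
have extE b : T (b ⊔ b ⊢ b) -> (forall J, cosat v b J <-> sval J b) ->
    forall F : obj K, (forall J, cosat v b J -> inc F J) <-> sval F b.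
  move=> bb cosatE F; rewrite -[sval F b]/(canonical_ext b F).
  by rewrite -extent_canonical_int//; split=> H J Jb; apply: H; apply/cosatE.
elim: a => [x|b [sb cb] c [sc cc]|b [sb cb] c [sc cc]|b [sb cb]|b [sb cb]
    |b [sb cb]|b [sb cb]].
- split.
  + case: x => //= F; split=> //.
      by move=> _; exact: (ultra_top SM (svalP F)).
    by move/(ultra_bot SM (svalP F)).
  + case: x => //= J; split=> //.
      by move/(ultra_bot SJ (svalP J)).
    by move=> _; exact: (ultra_top SJ (svalP J)).
- have sbc F : sat v (b ⊓ c) F <-> sval F (b ⊓ c).
    by rewrite (ultra_meetE SM _ _ (svalP F)) /= sb sc.
  split=> // J; exact: (intE (b ⊓ c) (theory_PDBL (ax_meet_idem b c)) sbc J).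
- have cbc J : cosat v (b ⊔ c) J <-> sval J (b ⊔ c).
    by rewrite (ultra_meetE SJ _ _ (svalP J)) /= cb cc.
  split=> // F; exact: (extE (b ⊔ c) (theory_PDBL (ax_join_idem b c)) cbc F).
- have snb F : sat v (¬ b) F <-> sval F (¬ b).
    by rewrite (ultra_neg (svalP F)) /= sb.
  split=> // J; exact: (intE (¬ b) (neg_le_idem SM b) snb J).
- have cnb J : cosat v (⌟ b) J <-> sval J (⌟ b).
    by rewrite (ultra_neg (svalP J)) /= cb.
  split=> // F; exact: (extE (⌟ b) (neg_le_idem SJ b) cnb F).
- have sbb F : sat v (□ b) F <-> sval F (□ b).
    rewrite (ultra_box SM _ (svalP F)) /=; split=> [H F1 uF1 FF1|H F1 FF1].
      exact/(sb (exist _ F1 uF1))/H.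
    exact/sb/(H _ (svalP F1) FF1).
  split=> // J; exact: (intE (□ b) (box_le_idem SM b) sbb J).
- have cbb J : cosat v (■ b) J <-> sval J (■ b).
    rewrite (ultra_box SJ _ (svalP J)) /=; split=> [H J1 uJ1 JJ1|H J1 JJ1].
      exact/(cb (exist _ J1 uJ1))/H.
    exact/cb/(H _ (svalP J1) JJ1).
  split=> // F; exact: (extE (■ b) (box_le_idem SJ b) cbb F).
Qed.

(** Separation by objects yields only [a ⊓ a ⊢ b], and by properties only [a ⊢ b ⊔ b];
    [theory_order] combines them into [a ⊢ b]. *)
Lemma sequent_satisfied_theory s : sequent_satisfied v s -> T s.
Proof.
case: s => a b [/= sab cab].
have aab : T (a ⊓ a ⊢ b).
  apply: contrapT => /(ultra_separation SM) [F [uF Fa]]; apply.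
  by apply/((truth b).1 (exist _ F uF))/sab/(truth a).1.
have abb : T (a ⊢ b ⊔ b).
  apply: contrapT => /(ultra_separation SJ) [J [uJ Jb]]; apply.
  by apply/((truth a).2 (exist _ J uJ))/cab/(truth b).2.
apply: (theory_order hT).
- exact: (le_meet SM (meet_lel SM a b) (meet_lel SM a b) (meet_le_idem SM a b)).
- exact: (le_meet SM (meet_lel SM a a) aab (meet_le_idem SM a a)).
- exact: (le_meet SJ abb (meet_lel SJ b b) (meet_le_idem SJ b b)).
- exact: (le_meet SJ (meet_ler SJ a b) (meet_ler SJ a b) (meet_le_idem SJ a b)).
Qed.

End CanonicalModel.

(** * Completeness for reflexive and transitive Kripke contexts *)

Theorem theorem83 (h : hypersequent) (hvalid : valid_in KC_RT h) :
  MPDBL4_provable h.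
Proof.
apply: contrapT => /theory_avoiding [T hT hT'].
have /List.Exists_exists [s [sh sv]] := hvalid _ (canonical_kc_RT hT) (canonical_model hT).
exact: hT' sh (sequent_satisfied_theory sv).
Qed.
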